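(* Let $L_n=\mathrm{LB}_n(111,1221)$. Then $L_0=L_1=1$ and, for $n\ge 2$, $$L_n=L_{n-1}+L_{n-2}+\sum_{k=1}^{n-2}q^k L_{k-1}L_{n-k-1}.$$
   Context: A restricted growth function (RGF) of length $n$ is a sequence $w=w_1\dots w_n$ of positive integers with $w_1=1$ and $w_i\le 1+\max\{w_1,\dots,w_{i-1}\}$ for $i\ge 2$; $R_0$ consists of the empty word and $R_n$ is the set of RGFs of length $n$. The standardization of a word replaces every occurrence of its smallest letter by $1$, of its next smallest letter by $2$, and so on. An RGF $w$ contains an RGF $v$ if some subword (subsequence, not necessarily consecutive) of $w$ standardizes to $v$; otherwise $w$ avoids $v$. $R_n(v_1,v_2)$ is the set of $w\in R_n$ avoiding both $v_1$ and $v_2$. For a word $w$ and position $j$, $\mathrm{lb}(w_j)$ is the number of distinct values $w_i$ with $i<j$ and $w_i>w_j$, $\mathrm{lb}(w)=\sum_j\mathrm{lb}(w_j)$, and $\mathrm{LB}_n(v_1,v_2)=\sum_{w\in R_n(v_1,v_2)}q^{\mathrm{lb}(w)}$. *)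

(* Defs.v *)
From mathcomp Require Import all_boot all_order all_algebra.

Set Implicit Arguments.
Unset Strict Implicit.
Unset Printing Implicit Defensive.

Import GRing.Theory.
Local Open Scope nat_scope.

(* Positions are 0-based: the letter w_(i+1) of a word is [nth 0 w i], and the
   letters before it form [take i w]. The empty word is an RGF. *)
Definition is_rgf (w : seq nat) : bool :=
  [&& all (fun x => 0 < x) w,
      head 1 w == 1
    & [forall i : 'I_(size w),
        (0 < i) ==> (nth 0 w i <= 1 + \max_(x <- take i w) x)]].

(* The j-th smallest distinct letter of w is replaced by j, the number of
   distinct letters of w that are at most that letter. *)
Definition standardize (w : seq nat) : seq nat :=
  [seq size (undup [seq y <- w | y <= x]) | x <- w].

(* Masks enumerate the subwords, so that containment is boolean;
   see [rgf_containsP]. *)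
Definition rgf_contains (w v : seq nat) : bool :=
  [exists m : (size w).-tuple bool, standardize (mask m w) == v].

Definition lb_at (w : seq nat) (j : nat) : nat :=
  size (undup [seq x <- take j w | nth 0 w j < x]).

Definition lb (w : seq nat) : nat := \sum_(j < size w) lb_at w j.

Definition word_of (n : nat) (t : n.-tuple 'I_n.+1) : seq nat :=
  map (@nat_of_ord n.+1) t.

(* A letter of an RGF of length n is at most n, so nothing is lost by taking
   the letters in {0, ..., n}; see [rgf_word_of]. *)
Definition R_avoid (n : nat) (v1 v2 : seq nat) : {set n.-tuple 'I_n.+1} :=
  [set t | [&& is_rgf (word_of t),
               ~~ rgf_contains (word_of t) v1
             & ~~ rgf_contains (word_of t) v2]].

(* The variable q is 'X. *)
Definition LB (v1 v2 : seq nat) (n : nat) : {poly int} :=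
  (\sum_(t in R_avoid n v1 v2) 'X^(lb (word_of t)))%R.

Lemma rgf_containsP (w v : seq nat) :
  reflect (exists2 s, subseq s w & standardize s = v) (rgf_contains w v).
Proof.
apply: (iffP existsP) => [[m /eqP mv]|[s /subseqP[m sz_m ->] sv]].
  by exists (mask m w) => //; apply: mask_subseq.
have sz : size m == size w by apply/eqP.
by exists (Tuple sz); rewrite /= sv.
Qed.

Lemma rgf_nth_le (w : seq nat) (i : nat) :
  is_rgf w -> i < size w -> nth 0 w i <= i.+1.
Proof.
case/and3P=> _ hd /forallP rgf.
elim/ltn_ind: i => -[|i] IH lt_i.
  by case: w hd {rgf IH} lt_i => //= x s /eqP ->.
have /implyP/(_ isT)/leq_trans := rgf (Ordinal lt_i); apply.
rewrite add1n ltnS; apply/bigmax_leqP_seq => x /(nthP 0)[j].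
rewrite size_take lt_i => lt_j <- _; rewrite nth_take //.
by apply: leq_trans (IH _ lt_j (ltn_trans lt_j lt_i)) _.
Qed.

Lemma rgf_word_of (n : nat) (w : seq nat) :
  is_rgf w -> size w = n -> exists t : n.-tuple 'I_n.+1, word_of t = w.
Proof.
move=> rgf sz.
have sz' : size [seq (inord x : 'I_n.+1) | x <- w] == n by rewrite size_map sz.
exists (Tuple sz'); rewrite /word_of /= -map_comp -[RHS]map_id.
apply/eq_in_map => x /(nthP 0)[i lt_i <-] /=; rewrite inordK // ltnS.
by apply: leq_trans (rgf_nth_le rgf lt_i) _; rewrite -sz.
Qed.

Lemma word_of_inj (n : nat) : injective (@word_of n).
Proof. by move=> s t /(inj_map val_inj)/val_inj. Qed.

(* Main.v *)
Require Import Defs.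
From mathcomp Require Import all_boot all_order all_algebra.
From mathcomp Require Import zify ring.
Import GRing.Theory.

Set Implicit Arguments.
Unset Strict Implicit.
Unset Printing Implicit Defensive.

(* Read an avoider from left to right. If M is the largest letter so far and c
   the last letter that was a repetition, the next letter x is admissible iff
   c < x <= M + 1, and it contributes M - x to lb (0 if x = M + 1). Hence the
   generating function V(n, m) of the continuations of length n depends only on
   m = M - c, with
     V(n + 1, m) = V(n, m + 1) + sum_(j < m) q^j V(n, j)   and L_n = V(n, 0).
   (V is [ext_gf] and P, below, is [diag_gf].) Put
     P(n, m) = sum_(i <= n) q^i V(n - i, m + i).
   Then
     V(n + 1, m + 1) = V(n + 1, m) + q^m P(n, m),
   from which P(n, a + 1) and sum_(k <= n) q^k V(k, a) V(n - k, 1) satisfy the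
   same recursion in n; the case a = 0 of their equality gives the theorem. *)

(** * Standardization, the two patterns, and words extended by one letter *)

Section Containment.
Local Open Scope nat_scope.

(** These sizes are the letters that [standardize] puts for [x] and [y]; [y] itself is counted only
    in the second. *)
Lemma rank_lt (s : seq nat) (x y : nat) : y \in s -> x < y ->
  size (undup [seq z <- s | z <= x]) < size (undup [seq z <- s | z <= y]).
Proof.
move=> ys xy.
have := @uniq_leq_size _ (y :: undup [seq z <- s | z <= x])
  (undup [seq z <- s | z <= y]).
apply=> [/=|z]; rewrite ?undup_uniq ?mem_undup ?mem_filter ?andbT.
  by rewrite leqNgt xy.
rewrite inE !mem_undup !mem_filter => /predU1P[->|/andP[zx ->]].
  by rewrite leqnn ys.
by rewrite andbT (leq_trans zx (ltnW xy)).
Qed.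

Lemma rank_eq (s : seq nat) (x y : nat) : x \in s -> y \in s ->
  size (undup [seq z <- s | z <= x]) = size (undup [seq z <- s | z <= y]) ->
  x = y.
Proof.
move=> xs ys e; case: (ltngtP x y) => // [/(rank_lt ys)|/(rank_lt xs)].
  by rewrite e ltnn.
by rewrite e ltnn.
Qed.

Lemma contains111P (w : seq nat) :
  reflect (exists a, subseq [:: a; a; a] w) (rgf_contains w [:: 1; 1; 1]).
Proof.
apply: (iffP (rgf_containsP _ _)) => [[s sw]|[a aw]]; last first.
  by exists [:: a; a; a]; rewrite // /standardize /= !leqnn /= !inE eqxx.
case: s sw => [|a [|b [|c [|? ?]]]] // sw [e1 e2 e3]; exists a.
have eb : b = a by apply: (@rank_eq [:: a; b; c]);
  rewrite ?inE ?eqxx ?orbT // /= e1 e2.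
have ec : c = a by apply: (@rank_eq [:: a; b; c]);
  rewrite ?inE ?eqxx ?orbT // /= e1 e3.
by rewrite eb ec in sw.
Qed.

Lemma contains1221P (w : seq nat) :
  reflect (exists a b, a < b /\ subseq [:: a; b; b; a] w)
          (rgf_contains w [:: 1; 2; 2; 1]).
Proof.
apply: (iffP (rgf_containsP _ _)) => [[s sw]|[a [b [ab aw]]]]; last first.
  exists [:: a; b; b; a] => //; rewrite /standardize /= !leqnn (ltnW ab).
  by rewrite leqNgt ab /= !inE !eqxx ?orbT /= ?(ltn_eqF ab) ?(gtn_eqF ab) ?orbT.
case: s sw => [|a [|b [|c [|d [|? ?]]]]] // sw [e1 e2 e3 e4]; exists a, b.
have ec : c = b by apply: (@rank_eq [:: a; b; c; d]);
  rewrite ?inE ?eqxx ?orbT // /= e2 e3.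
have ed : d = a by apply: (@rank_eq [:: a; b; c; d]);
  rewrite ?inE ?eqxx ?orbT // /= e1 e4.
split; last by rewrite ec ed in sw.
case: (ltngtP a b) => // [ba|ab].
  have := @rank_lt [:: a; b; c; d] b a.
  by rewrite !inE eqxx /= e1 e2 => /(_ isT ba).
by move: e1 e2; rewrite ab => ->.
Qed.

(** For empty [p] the maximum is 0, so the two bounds on [x] amount to the head condition
    [x = 1]. *)
Lemma is_rgf_rcons (p : seq nat) (x : nat) :
  is_rgf (rcons p x) = [&& is_rgf p, 0 < x & x <= 1 + \max_(y <- p) y].
Proof.
rewrite /is_rgf all_rcons.
case: (posnP x) => [->|x0] /=; first by rewrite !andbF.
suff -> : [forall i : 'I_(size (rcons p x)), (0 < i) ==>
     (nth 0 (rcons p x) i <= 1 + \max_(y <- take i (rcons p x)) y)] =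
   [forall i : 'I_(size p), (0 < i) ==>
     (nth 0 p i <= 1 + \max_(y <- take i p) y)] &&
   ((0 < size p) ==> (x <= 1 + \max_(y <- p) y)).
  case: p => [|a p] /=; last by rewrite -!andbA.
  rewrite big_nil addn0 andbT andbC; congr (_ && _); lia.
have nthE i : i < size p -> nth 0 (rcons p x) i = nth 0 p i.
  by move=> ip; rewrite nth_rcons ip.
have takeE i : i < size p -> take i (rcons p x) = take i p.
  by move=> ip; rewrite -cats1 takel_cat // ltnW.
have nth_last : nth 0 (rcons p x) (size p) = x by rewrite nth_rcons ltnn eqxx.
have take_last : take (size p) (rcons p x) = p by rewrite -cats1 take_size_cat.
apply/forallP/andP => [h|[/forallP h hx] [i /= ip]].
  split.
    apply/forallP => -[i ip] /=.
    have lt : i < size (rcons p x) by rewrite size_rcons ltnS ltnW.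
    by have := h (Ordinal lt); rewrite /= nthE // takeE.
  have lt : size p < size (rcons p x) by rewrite size_rcons.
  by have := h (Ordinal lt); rewrite /= nth_last take_last.
move: ip; rewrite size_rcons ltnS leq_eqVlt => /predU1P[->|ip].
  by rewrite nth_last take_last.
by have := h (Ordinal ip); rewrite /= nthE // takeE.
Qed.

Lemma lb_rcons (p : seq nat) (x : nat) :
  lb (rcons p x) = lb p + size (undup [seq y <- p | x < y]).
Proof.
rewrite /lb size_rcons big_ord_recr /=; congr (_ + _).
  apply: eq_bigr => i _; rewrite /lb_at nth_rcons ltn_ord -cats1 takel_cat //.
  exact: ltnW.
by rewrite /lb_at nth_rcons ltnn eqxx -cats1 take_size_cat.
Qed.

(** Reversing both words turns this into the defining clause of [subseq]. *)
Lemma subseq_rconsE (s p : seq nat) (a x : nat) :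
  subseq (rcons s a) (rcons p x) =
  if x == a then subseq s p else subseq (rcons s a) p.
Proof.
by rewrite -subseq_rev !rev_rcons /= eq_sym; case: eqP;
  rewrite -?rev_rcons subseq_rev.
Qed.

End Containment.

(** * Recurrences for V and P *)

Section Recurrence.

Variables (R : comNzRingType) (q : R).
Local Open Scope ring_scope.

(* An avoider with [m] letters that may still be repeated is continued either by
   a new maximum ([lb] 0, state [m.+1]) or by the repeatable letter that has [j]
   larger ones ([lb] [j], state [j], the smaller ones being blocked by 1221). *)
Fixpoint ext_gf (n m : nat) : R :=
  if n is n'.+1 then ext_gf n' m.+1 + \sum_(j < m) q ^+ j * ext_gf n' j else 1.

Fixpoint diag_gf (n m : nat) : R :=
  ext_gf n m + (if n is n'.+1 then q * diag_gf n' m.+1 else 0).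

(** Subtracting the recursions of the two V leaves the term j = m and the same difference for (n -
    1, m + 1); iterating it produces P. *)
Lemma ext_gfS n m : ext_gf n.+1 m.+1 = ext_gf n.+1 m + q ^+ m * diag_gf n m.
Proof.
elim: n m => [|n IHn] m; first by rewrite /= big_ord_recr /=; ring.
rewrite [LHS]/= -/(ext_gf n.+1 m.+2) big_ord_recr IHn /= exprS.
by rewrite -/(ext_gf n.+1 m.+1); ring.
Qed.

Lemma ext_gfS_sum n a :
  ext_gf n.+1 a.+1 = ext_gf n.+1 1 + \sum_(j < a) q ^+ j.+1 * diag_gf n j.+1.
Proof.
elim: a => [|a IHa]; first by rewrite big_ord0 addr0.
by rewrite ext_gfS IHa big_ord_recr /= addrA.
Qed.

Lemma diag_gf_convolution n a :
  diag_gf n a.+1 = \sum_(k < n.+1) q ^+ k * ext_gf k a * ext_gf (n - k) 1.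
Proof.
elim: n a => [|n IHn] a; first by rewrite big_ord1 /=; ring.
rewrite big_ord_recl subn0 /= -/(ext_gf n.+1 a.+1) -/(ext_gf n.+1 1) ext_gfS_sum.
rewrite expr0 !mul1r -addrA; congr (_ + _).
(* The recursion of V(k + 1, a) splits the convolution: its first term gives q P(n, a + 2) by
   induction, its j-th summand gives q^(j + 1) P(n, j + 1). *)
under [X in _ = X]eq_bigr => k _.
  rewrite /bump /= add1n subSS exprS mulrDr mulrDl mulr_sumr mulr_suml.
  over.
rewrite big_split /= addrC exchange_big /=; congr (_ + _).
  by rewrite IHn mulr_sumr; apply: eq_bigr => k _; rewrite !mulrA.
apply: eq_bigr => j _; rewrite IHn mulr_sumr; apply: eq_bigr => k _.
by rewrite exprS; ring.
Qed.

Lemma ext_gf_recurrence n :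
  ext_gf n.+2 0 = ext_gf n.+1 0 + ext_gf n 0
             + \sum_(1 <= k < n.+1) q ^+ k * ext_gf k.-1 0 * ext_gf (n.+1 - k) 0.
Proof.
(* With no repeatable letter, the next one must be a new maximum. *)
have ext_gf0 k : ext_gf k.+1 0 = ext_gf k 1 by rewrite /= big_ord0 addr0.
rewrite ext_gf0 ext_gfS mul1r -[RHS]addrA; congr (_ + _).
case: n => [|n]; first by rewrite big_geq //= !addr0.
rewrite /= -/(ext_gf n.+1 0) diag_gf_convolution; congr (_ + _).
rewrite big_add1 /= big_mkord mulr_sumr; apply: eq_bigr => k _.
by rewrite subSS subSn ?ext_gf0 ?exprS ?mulrA // -ltnS.
Qed.

End Recurrence.

(** * Enumeration of the avoiders letter by letter *)

Section Extensions.
Local Open Scope nat_scope.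

Definition good (w : seq nat) : bool :=
  [&& is_rgf w, ~~ rgf_contains w [:: 1; 1; 1]
    & ~~ rgf_contains w [:: 1; 2; 2; 1]].

Lemma good_prefix (p s : seq nat) : good (p ++ s) -> good p.
Proof.
elim/last_ind: s => [|s x IHs]; first by rewrite cats0.
rewrite -rcons_cat /good is_rgf_rcons => /and3P[/and3P[rw _ _] n1 n2].
apply: IHs; rewrite /good rw /=; apply/andP; split.
  apply: contra n1 => /contains111P[a aw]; apply/contains111P; exists a.
  exact: subseq_trans aw (subseq_rcons _ _).
apply: contra n2 => /contains1221P[a [b [ab aw]]]; apply/contains1221P.
by exists a, b; split=> //; apply: subseq_trans aw (subseq_rcons _ _).
Qed.

(* [M] is the largest letter read and [c] the last letter that was a repetition;
   both are 0 when there is none. *)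
Record state (p : seq nat) (M c : nat) : Prop := State {
  state_good : good p;
  state_mem : forall x, (x \in p) = (0 < x <= M);
  state_order : forall x y, 0 < x < y -> y <= M -> subseq [:: x; y] p;
  state_single : forall x, c < x -> ~~ subseq [:: x; x] p;
  state_double : 0 < c -> subseq [:: c; c] p;
  state_closed : forall x, 0 < x < c -> subseq [:: x; c; c] p;
  state_le : c <= M }.

Lemma state_nil : state [::] 0 0.
Proof.
split=> // [|x|x y|x]; rewrite ?in_nil; try lia.
rewrite /good; apply/and3P; split.
- by apply/and3P; split=> //; apply/forallP => -[].
- by apply/contains111P => -[].
by apply/contains1221P => -[a [b []]].
Qed.

Lemma state_max p M c : state p M c -> \max_(y <- p) y = M.
Proof.
move=> st; apply/eqP; rewrite eqn_leq; apply/andP; split.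
  by apply/bigmax_leqP_seq => x; rewrite (state_mem st) => /andP[].
case: M st => // M st; apply: (@leq_bigmax_seq _ _ xpredT id) => //.
by rewrite (state_mem st) ltnS leqnn.
Qed.

(* A repeated letter [x <= c] would create 111 or, with [c], 1221. *)
Lemma good_rcons p M c x : state p M c -> good (rcons p x) = (c < x <= M.+1).
Proof.
move=> st; have [/and3P[rp n1 n2] memp _ single dbl closed cM] := st.
apply/idP/idP => [|/andP[cx xM]].
  rewrite /good is_rgf_rcons (state_max st) => /and3P[/and3P[_ x0 xM] m1 m2].
  rewrite xM andbT ltnNge; apply/negP => xc.
  move: xc; rewrite leq_eqVlt => /predU1P[xc|xc].
    case/negP: m1; apply/contains111P; exists x.
    rewrite -[[:: x; x; x]]/(rcons [:: x; x] x) subseq_rconsE eqxx xc.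
    by apply: dbl; rewrite -xc.
  case/negP: m2; apply/contains1221P; exists x, c; split=> //.
  rewrite -[[:: x; c; c; x]]/(rcons [:: x; c; c] x) subseq_rconsE eqxx.
  by apply: closed; rewrite x0.
rewrite /good is_rgf_rcons rp (state_max st) xM (leq_ltn_trans _ cx) //=.
apply/andP; split.
  apply/contains111P => -[a].
  rewrite -[[:: a; a; a]]/(rcons [:: a; a] a) subseq_rconsE.
  case: eqP => [<-|_] h; first by rewrite (negPf (single _ cx)) in h.
  by case/contains111P: n1; exists a.
apply/contains1221P => -[a [b [ab]]].
rewrite -[[:: a; b; b; a]]/(rcons [:: a; b; b] a) subseq_rconsE.
case: eqP => [xa|_] h; last by case/contains1221P: n2; exists a, b.
(* A 1221 ending in the new letter needs a larger letter already repeated, but no letter above [c]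
   is. *)
have cb : c < b by apply: ltn_trans cx _; rewrite xa.
case/negP: (single b cb).
exact: subseq_trans (subseq_cons _ _) h.
Qed.

Lemma state_rcons p M c x : state p M c -> c < x <= M.+1 ->
  state (rcons p x) (maxn M x) (if x <= M then x else c).
Proof.
move=> st cxM; have g := good_rcons x st; rewrite cxM in g.
have [_ memp order single dbl closed cM] := st.
have sub s : subseq s p -> subseq s (rcons p x).
  by move=> h; apply: subseq_trans h (subseq_rcons _ _).
have pair y z : subseq [:: y; z] (rcons p x) =
    if x == z then y \in p else subseq [:: y; z] p.
  by rewrite -[[:: y; z]]/(rcons [:: y] z) subseq_rconsE sub1seq.
split=> //.
- by move=> y; rewrite mem_rcons inE memp; case: eqP => /=; lia.
- move=> y z yz zM; rewrite pair; case: eqP => [xz|xz]; first by rewrite memp; lia.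
  by apply: order => //; lia.
- move=> y; rewrite pair; case: eqP => [<-|_]; last first.
    by case: ifP => _ h; apply: single; lia.
  by case: ifP => xM; rewrite ?ltnn // memp; lia.
- rewrite pair; case: ifP => xM c0; first by rewrite eqxx memp; lia.
  by case: eqP => [|_]; [lia | apply: dbl].
- move=> y; case: ifP => xM yx; last by apply: sub; apply: closed.
  (* By [state_order], [y] already precedes an occurrence of [x]; the new letter is the second
     [x]. *)
  rewrite -[[:: y; x; x]]/(rcons [:: y; x] x) subseq_rconsE eqxx.
  exact: order.
by case: ifP; lia.
Qed.

(** The letters read are exactly 1, ..., [M]; truncated subtraction gives 0 for a new maximum. *)
Lemma lb_state p M c x : state p M c -> lb (rcons p x) = lb p + (M - x).
Proof.
move=> st; rewrite lb_rcons -(size_iota x.+1 (M - x)); congr (_ + _).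
apply/perm_size/uniq_perm; rewrite ?undup_uniq ?iota_uniq // => y.
by rewrite mem_undup mem_filter mem_iota (state_mem st); lia.
Qed.

Fixpoint extensions (n M c : nat) : seq (seq nat) :=
  if n is n'.+1 then
    [seq x :: s | x <- iota c.+1 (M.+1 - c),
                  s <- extensions n' (maxn M x) (if x <= M then x else c)]
  else [:: [::]].

Lemma extensions_uniq n M c : uniq (extensions n M c).
Proof.
elim: n M c => //= n IHn M c; apply: allpairs_uniq_dep => [|x _|].
- exact: iota_uniq.
- exact: IHn.
by move=> [x s] [y t] _ _ [/= -> ->].
Qed.

Lemma mem_extensions n p M c s : state p M c ->
  (s \in extensions n M c) = (size s == n) && good (p ++ s).
Proof.
elim: n p M c s => [|n IHn] p M c [|x s] st.
- by rewrite inE cats0 (state_good st).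
- by rewrite inE.
- by apply/allpairsPdep => -[? [? []]].
rewrite eqSS -cat_rcons; apply/allpairsPdep/andP => [[y [t []]]|[ss g]].
  rewrite mem_iota => ylt tin [-> ->].
  have cyM : c < y <= M.+1 by have := state_le st; lia.
  by apply/andP; rewrite -(IHn _ _ _ _ (state_rcons st cyM)).
have cxM := good_prefix g; rewrite (good_rcons x st) in cxM.
exists x, s; split=> //; first by rewrite mem_iota; lia.
by rewrite (IHn _ _ _ _ (state_rcons st cxM)) ss.
Qed.

Lemma sum_extensions (R : comNzRingType) (q : R) n p M c : state p M c ->
  (\sum_(s <- extensions n M c) q ^+ lb (p ++ s) =
   q ^+ lb p * ext_gf q n (M - c))%R.
Proof.
elim: n p M c => [|n IHn] p M c st.
  by rewrite big_seq1 cats0 mulr1.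
rewrite [extensions _ _ _]/= big_allpairs_dep.
under eq_big_seq => x xin.
  have cxM : c < x <= M.+1 by move: xin; rewrite mem_iota; lia.
  under eq_bigr => s _ do rewrite -cat_rcons.
  rewrite (IHn _ _ _ (state_rcons st cxM)) (lb_state x st) exprD -mulrA.
  over.
rewrite -mulr_sumr /=; congr (_ * _)%R.
have cM := state_le st.
(* The new maximum M + 1 is separated from the repeatable letters c + 1, ..., M. *)
have -> : iota c.+1 (M.+1 - c) = index_iota c.+1 M.+1 ++ [:: M.+1].
  by rewrite subSn // -[(M - c).+1]addn1 iotaD /index_iota subSS addSn subnKC.
rewrite big_cat big_seq1 addrC /= ltnn (maxn_idPr (leqnSn M)).
rewrite (eqP (leqnSn M)) mul1r subSn //.
(* Reversal sets x = M - j, so that j is both the contribution to [lb] and the new difference M -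
   x. *)
rewrite big_rev_mkord subSS; congr (_ + _)%R; apply: eq_bigr => j _.
rewrite subSS leq_subr (maxn_idPl (leq_subr _ _)) subKn //.
by apply: leq_trans (ltnW (ltn_ord j)) (leq_subr _ _).
Qed.

Lemma LB_ext_gf n : LB [:: 1; 1; 1] [:: 1; 2; 2; 1] n = ext_gf 'X%R n 0.
Proof.
have := sum_extensions ('X : {poly int})%R n state_nil.
have -> : lb [::] = 0 by rewrite /lb big_ord0.
rewrite expr0 mul1r => <-.
(* Moving from tuples to words leaves two duplicate-free lists to compare; [rgf_word_of] supplies
   the tuple for each avoider. *)
rewrite /LB -big_enum /= -(big_map (@word_of n) xpredT (fun w => 'X^(lb w))%R).
apply: perm_big; apply: uniq_perm; last 1 first.
- move=> w; rewrite (mem_extensions _ _ state_nil) /=.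
  apply/mapP/andP => [[t]|[/eqP sw gw]].
    rewrite mem_enum inE => gt ->; split=> //.
    by rewrite size_map size_tuple.
  have [t tw] := rgf_word_of (proj1 (andP gw)) sw.
  by exists t; rewrite // mem_enum inE tw.
- by rewrite (map_inj_uniq (@word_of_inj n)) enum_uniq.
exact: extensions_uniq.
Qed.

End Extensions.

Local Open Scope ring_scope.

Theorem theorem6p10 :
  let L := LB [:: 1; 1; 1]%N [:: 1; 2; 2; 1]%N in
  [/\ L 0%N = 1,
      L 1%N = 1
    & forall n : nat, (2 <= n)%N ->
        L n = L (n - 1)%N + L (n - 2)%N
              + \sum_(1 <= k < (n - 2).+1) 'X^k * L (k - 1)%N * L (n - k - 1)%N].
Proof.
move=> L; rewrite /L !LB_ext_gf; split=> //; first by rewrite /= big_ord0 addr0.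
case=> [|[|n]] // _; rewrite !LB_ext_gf ext_gf_recurrence !subSS !subn0.
congr (_ + _).
by apply: eq_bigr => k _; rewrite !LB_ext_gf subn1 subnAC subn1.
Qed.
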